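(* There is a universal constant $c$ for which \[ f'(n;r)\ge\exp\{c\,r^{1/5}\} \] for all $n$ sufficiently large compared to $r$.
   Context: $Q_n=\{\pm1\}^n$ is equipped with the Hamming distance $d$, where $d(x,y)$ is the number of coordinates in which $x$ and $y$ differ. For a scale $r\ge 0$, the Vietoris--Rips complex $\mathcal{VR}(Q_n;r)$ is the simplicial complex with vertex set $Q_n$ whose simplices are the nonempty subsets $\sigma\subseteq Q_n$ with $d(x,y)\le r$ for all $x,y\in\sigma$. A facet is a simplex that is maximal under inclusion. A simplex $\sigma\in\mathcal{VR}(Q_n;r)$ is rigid if $\max_{y\in\sigma}d(x,y)=r$ for every $x\in\sigma$. $F'(n;r)$ denotes the set of all rigid facets of $\mathcal{VR}(Q_n;r)$, and $f'(n;r)=|\{\dim\sigma:\sigma\in F'(n;r)\}|$ is the number of different dimensions of rigid facets, where $\dim\sigma=|\sigma|-1$.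
   Formalization: The constant c is taken positive and the bound is asserted for integers r at least a universal threshold r_0: for r=1 all rigid facets are edges, so f'(n;1)=1 < e^c, and for non-integral r there are no rigid facets at all. *)

(* Defs.v *)
From mathcomp Require Import all_boot.

Set Implicit Arguments.
Unset Strict Implicit.
Unset Printing Implicit Defensive.

(* The hypercube {+1, -1}^n, where the bit b stands for the sign (-1)^b. *)
Definition cube (n : nat) := {ffun 'I_n -> bool}.

Definition hamming (n : nat) (x y : cube n) : nat := #|[set i | x i != y i]|.

(* Scales are natural numbers: as the Hamming distance is integer-valued, there
   are no rigid simplices at a non-integral scale. *)
Definition vietoris_rips (n r : nat) : {set {set cube n}} :=
  [set s : {set cube n} |
    (s != set0) && [forall x in s, forall y in s, hamming x y <= r]].

Definition facets (T : finType) (K : {set {set T}}) : {set {set T}} :=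
  [set s | maxset (fun t => t \in K) s].

Definition rigid (n r : nat) (s : {set cube n}) : bool :=
  (s \in vietoris_rips n r) &&
  [forall x in s, \max_(y in s) hamming x y == r].

Definition simplex_dim (T : finType) (s : {set T}) : nat := #|s|.-1.

Definition rigid_facets (n r : nat) : {set {set cube n}} :=
  [set s in facets (vietoris_rips n r) | rigid r s].

Definition rigid_facet_dims (n r : nat) : nat :=
  size (undup [seq simplex_dim s | s in rigid_facets n r]).

(* Main.v *)
Require Import Defs.
From mathcomp Require Import all_boot all_order all_algebra.
From mathcomp Require Import all_classical all_reals all_analysis.
From mathcomp Require Import zify.

Import Order.TTheory GRing.Theory Num.Theory.
Local Open Scope ring_scope.

Set Implicit Arguments.
Unset Strict Implicit.
Unset Printing Implicit Defensive.

(** The bound comes from an explicit family of rigid facets whose sizes fill an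
interval of integers of length 2^(r-5), which is far more than is asked for.

A set s is a rigid facet at scale r as soon as distances inside s are at most r,
every point of s has a point of s at distance exactly r, and every point outside
s has a point of s at distance more than r ([rigid_facetsP]). When r = n - 2, two
points are at distance more than r precisely when one is equal or adjacent to the
antipode of the other. So a rigid facet amounts to a labelling of Q_n: s carries
+, the antipodes of s carry -, the other points carry 0. No + is equal or
adjacent to a -, each 0 is adjacent to both a + and a -, and each + is adjacent
to a 0. The basic example is Q_5 * Q_2 labelled through the second factor only:
+ on 00, - on 11, and 0 on 01 and 10.

Such a labelling can be modified so that it acquires a switch: a place of Q_7
where the labels may be changed without disturbing the neighbours, the size of
the + set growing by two; the antipodal place then loses one point. This is
[gadget a b], where a says whether the switch is on and b whether the switch
of the antipodal copy is on. The switch is tight enough that all four variants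
fit side by side. Hence one can put a copy of Q_7 above each point v of Q_m,
and turn the switch on or off independently at each v: for every subset V of
Q_m this is a rigid facet of Q_(m+7) at scale m+5 ([tuned_facet_rigid]), of size
2^(m+5) + #|V| ([card_tuned_facet]).

A rigid facet stays one when the cube grows: a new vertex that differs from a
point p in the added coordinates is one step too far from the point of the facet
at distance at least r from p. So the 2^m sizes found for m = r - 5 occur in every
dimension n >= r + 2, and 2^(r-5) eventually exceeds exp(c r), for c = ln 2 / 2.

Both the growth of the cube and the family of copies of Q_7 are instances of one
statement about sets fibred over a rigid facet, [bundle_rigid_facet]. *)

(** * Hamming distance and rigid facets *)

Section Cubes.
Local Open Scope set_scope.
Local Open Scope nat_scope.

Lemma hamming_sum n (x y : cube n) : hamming x y = \sum_i (x i != y i).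
Proof. by rewrite /hamming cardsE -sum1_card big_mkcond. Qed.

Lemma hamming_sym n (x y : cube n) : hamming x y = hamming y x.
Proof. by rewrite !hamming_sum; apply: eq_bigr => i _; rewrite eq_sym. Qed.

Lemma hammingxx n (x : cube n) : hamming x x = 0.
Proof. by rewrite hamming_sum big1 // => i _; rewrite eqxx. Qed.

Lemma hamming_le n (x y : cube n) : hamming x y <= n.
Proof. by rewrite -[leqRHS]card_ord max_card. Qed.

Lemma hamming_eq0 n (x y : cube n) : hamming x y = 0 -> x = y.
Proof.
move/eqP; rewrite finset.cards_eq0 => /eqP E; apply/ffunP => i.
by have /setP/(_ i) := E; rewrite !inE => /negbFE/eqP.
Qed.

Lemma card_cube n : #|{: cube n}| = 2 ^ n.
Proof. by rewrite card_ffun card_bool card_ord. Qed.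

Definition antipode n (x : cube n) : cube n := [ffun i => ~~ x i].

Lemma antipodeK n : involutive (@antipode n).
Proof. by move=> x; apply/ffunP => i; rewrite !ffunE negbK. Qed.

Lemma hamming_antipode n (x y : cube n) : hamming x y = n -> y = antipode x.
Proof.
move=> h; have /eqP/setP E : [set i | x i != y i] == [set: 'I_n].
  by rewrite eqEcard finset.subsetT finset.cardsT card_ord /= -[leqLHS]h.
apply/ffunP => i; have := E i; rewrite !inE ffunE.
by case: (x i) (y i) => [] [].
Qed.

Lemma hammingN n (x : cube n) : hamming x (antipode x) = n.
Proof.
rewrite hamming_sum (eq_bigr (fun=> 1)) ?sum1_card ?card_ord // => i _.
by rewrite ffunE; case: (x i).
Qed.

(** Maximality against a single extra point suffices, since a larger simplex
contains one; together with rigidity it becomes a two-case condition on the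
distance to the farthest point, which is the form that is additive over
products. *)
Lemma rigid_facetsP n r (s : {set cube n}) :
  s \in rigid_facets n r <->
  {in s &, forall x y, hamming x y <= r} /\
  (forall x, exists2 y, y \in s &
     if x \in s then hamming x y = r else r < hamming x y).
Proof.
split.
  rewrite !inE => /andP[/maxsetP[sK smax] /andP[_ /forall_inP srig]].
  move: sK; rewrite inE => /andP[/set0Pn [x0 x0s] /forall_inP diam].
  have {}diam : {in s &, forall x y, hamming x y <= r}.
    by move=> x y /diam/forall_inP; apply.
  split=> // x; have [xs|xs] := boolP (x \in s).
    have s_gt0 : 0 < #|s| by apply/card_gt0P; exists x0.
    have [y ys] := bigop.eq_bigmax_cond (hamming x) s_gt0.
    by rewrite (eqP (srig x xs)) => ->; exists y.
  apply/exists_inP; apply: contraNT xs => /exists_inPn far.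
  have {}far y : y \in s -> hamming x y <= r by move=> /far; rewrite -leqNgt.
  rewrite -(smax (x |: s)) ?setU11 ?finset.subsetUr //.
  rewrite inE; apply/andP; split; first by apply/set0Pn; exists x; rewrite setU11.
  apply/forall_inP => y; rewrite in_setU1 => ys; apply/forall_inP => z.
  rewrite in_setU1 => zs.
  case/predU1P: ys => [->|ys]; case/predU1P: zs => [->|zs].
  - by rewrite hammingxx.
  - exact: far.
  - by rewrite hamming_sym far.
  - exact: diam.
move=> [diam far].
(* The condition at any one vertex of the cube shows that s is nonempty. *)
have [y0 y0s _] := far [ffun=> true].
have sK : s \in vietoris_rips n r.
  rewrite inE; apply/andP; split; first by apply/set0Pn; exists y0.
  by apply/forall_inP => x xs; apply/forall_inP => y ys; apply: diam.
rewrite inE /rigid sK /=; apply/andP; split.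
  rewrite inE; apply/maxsetP; split=> // t tK st.
  apply/eqP; rewrite finset.eqEsubset st andbT; apply/fintype.subsetP => x xt.
  have [y ys] := far x; case: ifP => // _; rewrite ltnNge => /negP[].
  move: tK; rewrite inE => /andP[_ /forall_inP/(_ x xt)/forall_inP]; apply.
  exact: (fintype.subsetP st).
apply/forall_inP => x xs; rewrite eqn_leq; apply/andP; split.
  by apply/bigmax_leqP => y ys; apply: diam.
have [y ys] := far x; rewrite xs => <-.
exact: (leq_bigmax_cond (F := hamming x)).
Qed.

(** * Sets fibred over a rigid facet *)

Definition cat_cube m n (v : cube m) (p : cube n) : cube (m + n) :=
  [ffun i => match fintype.split i with inl j => v j | inr k => p k end].
Definition lcube m n (x : cube (m + n)) : cube m := [ffun i => x (lshift n i)].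
Definition rcube m n (x : cube (m + n)) : cube n := [ffun i => x (rshift m i)].

Lemma cat_cubeK m n (v : cube m) (p : cube n) :
  lcube (cat_cube v p) = v /\ rcube (cat_cube v p) = p.
Proof.
split; apply/ffunP => i; rewrite !ffunE.
  by rewrite -[lshift _ _]/(unsplit (inl i)) unsplitK.
by rewrite -[rshift _ _]/(unsplit (inr i)) unsplitK.
Qed.

Lemma split_cubeK m n (x : cube (m + n)) : cat_cube (lcube x) (rcube x) = x.
Proof. by apply/ffunP => i; rewrite ffunE; case: split_ordP => j ->; rewrite ffunE. Qed.

Lemma hamming_cat m n (x y : cube (m + n)) :
  hamming x y = hamming (lcube x) (lcube y) + hamming (rcube x) (rcube y).
Proof.
by rewrite !hamming_sum big_split_ord; congr (_ + _);
   apply: eq_bigr => i _; rewrite !ffunE.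
Qed.

Definition bundle m n (B : {set cube m}) (F : cube m -> {set cube n}) :
  {set cube (m + n)} := [set x | (lcube x \in B) && (rcube x \in F (lcube x))].

Lemma card_bundle m n (B : {set cube m}) (F : cube m -> {set cube n}) :
  #|bundle B F| = \sum_(v in B) #|F v|.
Proof.
pose glue (vp : cube m * cube n) := cat_cube vp.1 vp.2.
have glueK : {on [pred x | x \in bundle B F], bijective glue}.
  exists (fun x => (lcube x, rcube x)) => [[v p] _|x _] /=; last exact: split_cubeK.
  by rewrite /glue /=; have [-> ->] := cat_cubeK v p.
rewrite -sum1_card (reindex _ glueK) /=.
rewrite (eq_bigl (fun vp => (vp.1 \in B) && (vp.2 \in F vp.1))); last first.
  by move=> [v p]; rewrite inE /glue /=; have [-> ->] := cat_cubeK v p.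
rewrite -(pair_big_dep (mem B) (fun v p => p \in F v) (fun _ _ => 1)) /=.
by apply: eq_bigr => v _; rewrite sum1_card.
Qed.

(** Distances add up over the two factors. Over a pair v, v' at the maximal
distance t, the fibres must therefore play the role of one rigid facet at scale s
for each other; over any other pair at least one unit is gained in the base, so
the fibres may be as far as s + 1 apart. The last hypothesis disposes of
points that lie over the complement of B: some v' in B is then at distance at
least t + 1, and reaching distance s in the fibre over v' is enough. *)
Lemma bundle_rigid_facet m n t s (B : {set cube m}) (F : cube m -> {set cube n}) :
    B \in rigid_facets m t ->
    (forall v v' p p', v \in B -> v' \in B -> p \in F v -> p' \in F v' ->
       hamming v v' = t -> hamming p p' <= s) ->
    (forall v v' p p', v \in B -> v' \in B -> p \in F v -> p' \in F v' ->
       hamming p p' <= s.+1) ->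
    (forall v p, v \in B -> exists v' p', [/\ v' \in B, p' \in F v',
       hamming v v' = t &
       if p \in F v then hamming p p' = s else s < hamming p p']) ->
    (forall v p, v \in B -> exists2 p', p' \in F v & s <= hamming p p') ->
  bundle B F \in rigid_facets (m + n) (t + s).
Proof.
move=> /rigid_facetsP [diamB farB] diamF diamF' farF reachF.
apply/rigid_facetsP; split.
  move=> x y; rewrite !inE hamming_cat => /andP[vB pF] /andP[v'B p'F].
  have := diamB _ _ vB v'B; rewrite leq_eqVlt => /predU1P[vv'|vv'].
    by rewrite vv' leq_add2l (diamF _ _ _ _ vB v'B).
  have := diamF' _ _ _ _ vB v'B pF p'F; lia.
move=> x; have [vB|vB] := boolP (lcube x \in B).
  have [v' [p' [v'B p'F vv' pp']]] := farF _ (rcube x) vB.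
  exists (cat_cube v' p'); rewrite ?inE ?hamming_cat; have [-> ->] := cat_cubeK v' p'.
    by rewrite v'B.
  by rewrite vB vv' /=; case: ifP pp' => _; [move=> -> | rewrite ltn_add2l].
have [v' v'B] := farB (lcube x); rewrite (negPf vB) => vv'.
have [p' p'F pp'] := reachF v' (rcube x) v'B.
exists (cat_cube v' p'); rewrite ?inE ?hamming_cat; have [-> ->] := cat_cubeK v' p'.
  by rewrite v'B.
by rewrite (negPf vB) /=; lia.
Qed.

Lemma cube_rigid_facet m : [set: cube m] \in rigid_facets m m.
Proof.
apply/rigid_facetsP; split=> [x y _ _|x]; first exact: hamming_le.
by exists (antipode x); rewrite ?inE ?hammingN.
Qed.

(** A single vertex is a rigid facet at scale 0, so that this is a bundle over
it. *)
Lemma rigid_facet_extend k n r (s : {set cube n}) :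
  s \in rigid_facets n r ->
  bundle [set [ffun=> true]] (fun=> s) \in rigid_facets (k + n) r.
Proof.
move=> sF; have /rigid_facetsP [diam far] := sF.
rewrite -[r]add0n; apply: bundle_rigid_facet.
- apply/rigid_facetsP; split=> [x y|x].
    by rewrite !inE => /eqP-> /eqP->; rewrite hammingxx.
  exists [ffun=> true]; rewrite !inE //; case: eqP => [->|xt].
    by rewrite hammingxx.
  by rewrite lt0n; apply/eqP => /hamming_eq0.
- by move=> v v' p p' _ _ ps p's _; apply: diam.
- by move=> v v' p p' _ _ ps p's; apply/leqW/diam.
- move=> v p vB; have [p' p's pp'] := far p.
  by exists v, p'; rewrite hammingxx.
- move=> v p _; have [p' p's pp'] := far p; exists p' => //.
  by case: ifP pp' => _ => [->|/ltnW].
Qed.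

(** * Computing in small cubes *)

Definition bits n (p : cube n) : seq bool := codom p.

Fixpoint words n : seq (seq bool) :=
  if n is n'.+1 then map (cons true) (words n') ++ map (cons false) (words n')
  else [:: [::]].

Fixpoint dist (s t : seq bool) : nat :=
  match s, t with b :: s', c :: t' => (b != c) + dist s' t' | _, _ => 0 end.

Lemma mem_words n (w : seq bool) : (w \in words n) = (size w == n).
Proof.
elim: n w => [|n IH] [|b w] //=; rewrite mem_cat.
  by apply/orP => -[] /mapP[].
rewrite eqSS -IH; have inj c : injective (cons c : seq bool -> _) by move=> s t [].
have other c : (c :: w \in map (cons (~~ c)) (words n)) = false.
  by apply/mapP => -[w' _ [/eqP]]; case: c.
by case: b; rewrite (mem_map (inj _)) (other true, other false) ?orbF.
Qed.

Lemma words_uniq n : uniq (words n).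
Proof.
elim: n => //= n IH; have inj c : injective (cons c : seq bool -> _) by move=> s t [].
rewrite cat_uniq !map_inj_uniq // IH andbT /=.
by apply/hasPn => _ /mapP[w _ ->]; apply/mapP => -[].
Qed.

(** The link between the cube, whose finite functions do not compute, and words
of booleans, on which statements about Q_7 are decided by evaluation. *)
Lemma words_bits n : perm_eq (words n) [seq bits p | p : cube n].
Proof.
apply: uniq_perm.
- exact: words_uniq.
- rewrite map_inj_uniq ?enum_uniq // => p q pq.
  by apply/ffunP => i; move/eq_in_map: pq; apply; rewrite mem_enum.
move=> w; rewrite mem_words; apply/eqP/mapP => [sw|[p _ ->]]; last first.
  by rewrite size_codom card_ord.
exists [ffun i : 'I_n => nth false w i]; first by rewrite mem_enum.
rewrite /bits codomE (eq_map (g := nth false w \o val)); last first.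
  by move=> i; rewrite /= ffunE.
by rewrite map_comp val_enum_ord -sw -/(mkseq _ _) mkseq_nth.
Qed.

Lemma all_words n (P : pred (seq bool)) :
  all P (words n) -> forall p : cube n, P (bits p).
Proof. by move/allP => allP p; apply: allP; rewrite mem_words size_codom card_ord. Qed.

Lemma has_words n (P : pred (seq bool)) :
  has P (words n) -> exists p : cube n, P (bits p).
Proof.
by case/hasP => w; rewrite (perm_mem (words_bits n)) => /mapP[p _ ->]; exists p.
Qed.

Lemma card_words n (P : pred (seq bool)) :
  #|[set p : cube n | P (bits p)]| = count P (words n).
Proof.
rewrite (seq.permP (words_bits n)) count_map cardsE cardE size_filter enumT.
exact: eq_count.
Qed.

Lemma hamming_bits n (p q : cube n) : hamming p q = dist (bits p) (bits q).
Proof.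
rewrite hamming_sum /bits /codom /image_mem -big_enum.
by elim: (enum _) => [|i e IH]; rewrite ?big_nil ?big_cons //= IH.
Qed.

(** * A facet with a switch *)

(** A point of Q_7 is read as (u, w) with u in Q_5 and w in Q_2; the labels of
the proof idea are listed here on w = 00, 01, 10, 11. Write |u| for the number of
ones of u, e for 11000, and e' for its complement 00111. Off the switches they are
   -00+ if |u| = 0,   0++0 if |u| = 1,   +00- if |u| = 2 or 3,
   0--0 if |u| = 4,   -00+ if |u| = 5.
Putting - at (00000, 00), inside a region of +, surrounds that point by zeros;
this makes room for the switch at e, which replaces +00- by +++0. The + at
(e, 00) is then no longer adjacent to any 0 within its fibre, but it is adjacent
to the zeros (10000, 00) and (01000, 00), and the 0 at (e, 11) is
adjacent to the - at (u, 11) for |u| = 3. Antipodally, the switch at e' replaces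
+00- by 0---. The definition gives the points labelled +; those labelled -
are the antipodes of the points labelled + in the state where a and b are
exchanged. *)
Definition gadget_word (a b : bool) (p : seq bool) : bool :=
  let u := take 5 p in let w := drop 5 p in
  match count id u with
  | 0 => w == [:: true; true]
  | 1 => w \in [:: [:: true; false]; [:: false; true]]
  | 2 => if a && (u == [:: true; true; false; false; false])
         then w != [:: true; true] else w == [:: false; false]
  | 3 => if b && (u == [:: false; false; true; true; true])
         then false else w == [:: false; false]
  | 4 => false
  | _ => w == [:: true; true]
  end.

Definition gadget a b : {set cube 7} := [set p | gadget_word a b (bits p)].

(** Switching on at e turns two zeros into +, and at e' one + into 0. *)
Lemma card_gadget (a b : bool) : #|gadget a b| + b = 2 ^ 5 + a.*2.
Proof. by rewrite /gadget card_words; case: a b => [] []; vm_compute. Qed.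

(** In the bundle over Q_m, the copies of Q_7 above antipodal points have their
states a and b exchanged, and face each other as in a rigid facet at scale 5. *)
Lemma gadget_opposite a b p q :
  p \in gadget a b -> q \in gadget b a -> hamming p q <= 5.
Proof.
rewrite !inE hamming_bits.
have /all_words/(_ p) : all (fun s => gadget_word a b s ==>
  all (fun t => gadget_word b a t ==> (dist s t <= 5)) (words 7)) (words 7).
  by case: a b => [] []; vm_compute.
by move=> /implyP near /near/all_words/(_ q)/implyP.
Qed.

(** The states are unrelated because above points that are not antipodal any two
copies may meet: no state puts + at a point whose antipode is + in another. *)
Lemma gadget_diam a b a' b' p q :
  p \in gadget a b -> q \in gadget a' b' -> hamming p q <= 6.
Proof.
rewrite !inE hamming_bits.
have /all_words/(_ p) : all (fun s => gadget_word a b s ==>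
  all (fun t => gadget_word a' b' t ==> (dist s t <= 6)) (words 7)) (words 7).
  by case: a b a' b' => [] [] [] []; vm_compute.
by move=> /implyP near /near/all_words/(_ q)/implyP.
Qed.

Lemma gadget_far a b p : exists2 q, q \in gadget b a &
  if p \in gadget a b then hamming p q = 5 else 5 < hamming p q.
Proof.
have /all_words/(_ p)/has_words [q /andP[qG pq]] : all (fun s => has (fun t =>
  gadget_word b a t &&
  if gadget_word a b s then dist s t == 5 else 5 < dist s t) (words 7)) (words 7).
  by case: a b => [] []; vm_compute.
exists q; rewrite inE // hamming_bits; case: ifP pq => // _; exact: eqP.
Qed.

(** * Facets of prescribed size *)

Definition tuned_facet m (V : {set cube m}) : {set cube (m + 7)} :=
  bundle [set: cube m] (fun v => gadget (v \in V) (antipode v \in V)).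

Lemma tuned_facet_rigid m (V : {set cube m}) :
  tuned_facet V \in rigid_facets (m + 7) (m + 5).
Proof.
apply: bundle_rigid_facet; first exact: cube_rigid_facet.
- move=> v v' p q _ _ pG qG /hamming_antipode v'E.
  by move: qG; rewrite v'E antipodeK; apply: gadget_opposite.
- by move=> v v' p q _ _; apply: gadget_diam.
- move=> v p _.
  have [q qG pq] := gadget_far (v \in V) (antipode v \in V) p.
  by exists (antipode v), q; split; rewrite ?antipodeK ?hammingN ?finset.in_setT.
- move=> v p _.
  have [q qG pq] := gadget_far (antipode v \in V) (v \in V) p.
  by exists q => //; case: ifP pq => _ => [->|/ltnW].
Qed.

(** Each v in V gains two points in its own fibre and loses one in the fibre
above its antipode. *)
Lemma card_tuned_facet m (V : {set cube m}) :
  #|tuned_facet V| = 2 ^ (m + 5) + #|V|.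
Proof.
have opp : \sum_(v : cube m) (antipode v \in V) = #|V|.
  rewrite (reindex_inj (inv_inj (@antipodeK m))) -sum1_card [RHS]big_mkcond /=.
  by apply: eq_bigr => v _; rewrite antipodeK; case: ifP.
have same : \sum_(v : cube m) (v \in V) = #|V|.
  by rewrite -sum1_card [RHS]big_mkcond.
(* Adding the lost points to both sides avoids the truncated subtraction. *)
apply/eqP; rewrite -(eqn_add2r #|V|) card_bundle -{1}opp.
rewrite (eq_bigl predT) => [|v]; last by rewrite inE.
rewrite -big_split /= (eq_bigr (fun v => 2 ^ 5 + (v \in V).*2)) => [|v _].
  rewrite big_split /= sum_nat_const card_cube -expnD.
  under eq_bigr => v _ do rewrite -addnn.
  by rewrite big_split /= same addnA.
exact: card_gadget.
Qed.

Lemma rigid_facet_dims_ge k m :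
  2 ^ m <= rigid_facet_dims (k + (m + 7)) (m + 5).
Proof.
rewrite -[leqLHS](size_iota 0) -(size_map (fun j => (2 ^ (m + 5) + j).-1)).
apply: uniq_leq_size.
  rewrite map_inj_uniq ?iota_uniq // => i j.
  by have := expn_gt0 2 (m + 5); lia.
move=> d /mapP[j]; rewrite mem_iota add0n => /andP[_ ltj ->].
rewrite mem_undup; apply/fintype.imageP.
pose V : {set cube m} := [set v in take j (enum (cube m))].
have cardV : #|V| = j.
  rewrite cardsE (card_uniqP _) ?take_uniq ?enum_uniq //.
  by rewrite size_takel // -cardE card_cube ltnW.
exists (bundle [set [ffun=> true] : cube k] (fun=> tuned_facet V)).
  exact/rigid_facet_extend/tuned_facet_rigid.
by rewrite /simplex_dim card_bundle big_set1 card_tuned_facet cardV.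
Qed.

End Cubes.

Theorem corollary13 (R : realType) :
  exists c : R, 0 < c /\
    exists r0 : nat, forall r : nat, (r0 <= r)%N ->
      exists n0 : nat, forall n : nat, (n0 <= n)%N ->
        expR (c * (r%:R `^ (5%:R^-1))) <= (rigid_facet_dims n r)%:R.
Proof.
(* With c = ln 2 / 2, it suffices that r^(1/5) / 2 <= r / 2 <= r - 5. *)
exists (ln 2 / 2); split; first by rewrite divr_gt0 // ln_gt0 // ltr1n.
exists 10 => r r10; exists (r + 2)%N => n n_ge.
have := rigid_facet_dims_ge (n - (r + 2)) (r - 5).
rewrite (_ : n - (r + 2) + (r - 5 + 7) = n)%N; last by lia.
rewrite subnK; last by lia.
rewrite -(ler_nat R); apply: le_trans.
rewrite natrX -[X in _ <= X ^+ _](@lnK _ 2) ?posrE // -expRM_natl ler_expR.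
rewrite mulrAC -mulrA [leRHS]mulrC ler_pM2l ?ln_gt0 ?ltr1n //.
apply: (@le_trans _ _ (r%:R / 2)).
  rewrite ler_pM2r ?invr_gt0 //.
  rewrite -[leRHS]powRr1 // ler_powR ?ler1n ?invf_le1 ?ler1n //; lia.
by rewrite ler_pdivrMr // -natrM ler_nat; lia.
Qed.
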